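(* Let $U\subseteq U'$ be quantitative equational theories over one signature $(\Omega,\mathrm{ar})$, with metric term monads $T_U$, $T_{U'}$ on $\mathsf{Met}$ and units $\eta^U$, $\eta^{U'}$. Let $n\ge 0$. (1) Every algebra of $\mathrm{Mod}(U')$ lies in $\mathrm{Mod}(U)$, so $\mathrm{Free}_{U'}A$ is an object of $\mathrm{Mod}(U)$ for every $A$ in $\mathsf{Met}$. There is one and only one natural transformation $q\colon T_U\Rightarrow T_{U'}$ such that, for every $A$ in $\mathsf{Met}$, $q_A\circ\eta^U_A=\eta^{U'}_A$ and $q_A\colon T_UA\to T_{U'}A$ underlies a morphism $\mathrm{Free}_UA\to\mathrm{Free}_{U'}A$ of $\mathrm{Mod}(U)$. It is a morphism of monads, and each of its components $q_A\colon T_UA\to T_{U'}A$ is a surjective nonexpansive map. (2) Applying $PH_n$ to $q$ gives a natural transformation $PH_n(q)\colon PH^U_n\Rightarrow PH^{U'}_n$, where $PH^U_n(A)=PH_n(T_UA)$ and $PH^{U'}_n(A)=PH_n(T_{U'}A)$ as functors $\mathsf{Met}\to\mathsf{Ab}^{([0,\infty),\le)}$. (3) Let $A$ be in $\mathsf{Met}$ and $\delta\in[0,\infty)$. Suppose $q_A$ is bijective and $d^{T_UA}(t,s)\le d^{T_{U'}A}(q_At,q_As)+\delta$ for all $t,s\in T_UA$. Then $d_I\bigl(PH^U_n(A),PH^{U'}_n(A)\bigr)\le(n+1)\delta$.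
   Context: Metric spaces. An extended metric space is a set $X$ with $d\colon X\times X\to[0,\infty]$ that is zero on the diagonal, symmetric, satisfies the triangle inequality, and has $d(x,y)=0\Rightarrow x=y$. $\mathsf{Met}$ is the category of these with nonexpansive maps. Syntax. A signature is a finite set $\Omega$ of operation symbols with an arity map $\mathrm{ar}\colon\Omega\to\mathbb{N}$; $\Omega_n=\mathrm{ar}^{-1}\{n\}$. $\Xi$ is a fixed countably infinite set of variables, $T_\Omega\Xi$ the set of $\Omega$-terms over $\Xi$. A substitution is a map $\sigma\colon\Xi\to T_\Omega\Xi$, extended to terms as the $\Omega$-homomorphism $\sigma^\sharp$. A quantitative equation $t=_\varepsilon s$ is a triple $(t,\varepsilon,s)\in\mathcal{E}=T_\Omega\Xi\times\mathbb{Q}_{\ge0}\times T_\Omega\Xi$. A quantitative inference is an element $(\Gamma,\varphi)$ of $\mathcal{I}=\mathcal{P}_{\mathrm{fin}}(\mathcal{E})\times\mathcal{E}$; it is basic if all equations of $\Gamma$ relate variables only. A deducibility relation is a relation ${\vdash}\subseteq 2^{\mathcal{E}}\times\mathcal{E}$ (arbitrary hypothesis sets) closed under, for all terms, $f\in\Omega_n$, $\varepsilon,\varepsilon'\in\mathbb{Q}_{\ge 0}$: $\varnothing\vdash t=_0t$; $\{t=_\varepsilon s\}\vdash s=_\varepsilon t$; $\{t=_\varepsilon s,s=_{\varepsilon'}u\}\vdash t=_{\varepsilon+\varepsilon'}u$; $\{t=_\varepsilon s\}\vdash t=_{\varepsilon+\varepsilon'}s$ for $\varepsilon'>0$; $\{t=_{\varepsilon'}s\mid\varepsilon'>\varepsilon\}\vdash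 t=_\varepsilon s$; $\{t_i=_\varepsilon s_i\mid 1\le i\le n\}\vdash f(t_1,\dots,t_n)=_\varepsilon f(s_1,\dots,s_n)$; $\Gamma\vdash t=_\varepsilon s$ implies $\sigma^\sharp\Gamma\vdash\sigma^\sharp t=_\varepsilon\sigma^\sharp s$ for every substitution $\sigma$; if $\Gamma\vdash\varphi$ for all $\varphi\in\Gamma'$ and $\Gamma'\vdash\psi$ then $\Gamma\vdash\psi$; $\varphi\in\Gamma$ implies $\Gamma\vdash\varphi$. For a set $S$ of basic inferences, $\vdash_S$ is the least deducibility relation containing $S$, and the quantitative equational theory induced by $S$ is $U=({\vdash_S})\cap\mathcal{I}$. A quantitative equational theory is one of this form. Semantics. A quantitative algebra is an $\Omega$-algebra $A$ with an extended metric $d^A$ such that for every $f\in\Omega_n$: if $d^A(a_i,b_i)\le\varepsilon$ for all $i$ then $d^A(f^A(a_1,\dots,a_n),f^A(b_1,\dots,b_n))\le\varepsilon$. It satisfies $(\Gamma,t=_\varepsilon s)$ if every assignment $\iota\colon\Xi\to A$ (extended to terms as the homomorphism $\iota^\sharp$) with $d^A(\iota^\sharp t',\iota^\sharp s')\le\varepsilon'$ for all $(t'=_{\varepsilon'}s')\in\Gamma$ has $d^A(\iota^\sharp t,\iota^\sharp s)\le\varepsilon$. Morphisms of quantitative algebras are nonexpansive $\Omega$-homomorphisms; $\mathrm{Mod}(U)$ is the full subcategory of quantitative algebras satisfying every inference in $U$. It is a known theorem (Mardare–Panangaden–Plotkin) that the forgetful functor $G_U\colon\mathrm{Mod}(U)\to\mathsf{Met}$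 has a left adjoint $\mathrm{Free}_U$; the metric term monad is the induced monad $T_U=G_U\mathrm{Free}_U$ on $\mathsf{Met}$, with unit $\eta^U$. A morphism of monads is a natural transformation compatible with units and multiplications. Homology. For $X$ in $\mathsf{Met}$, $N(X)$ is the simplicial set with $N(X)_n$ all tuples $\langle x_0,\dots,x_n\rangle$ of points of $X$, the face $d_i$ deleting $x_i$ and the degeneracy $s_i$ repeating it; $\lambda\langle x_0,\dots,x_n\rangle=\sum_{i=1}^nd(x_{i-1},x_i)$. $C_\bullet(X)$ is the normalised chain complex of $N(X)$ over $\mathbb{Z}$ (free on tuples with $x_{i-1}\ne x_i$ for all $i$, $\partial=\sum(-1)^id_i$), and $F_\ell C_\bullet(X)$, $\ell\in[0,\infty)$, the subcomplex spanned by such tuples with $\lambda\le\ell$. $PH_n(X)\colon([0,\infty),\le)\to\mathsf{Ab}$ is $\ell\mapsto H_n(F_\ell C_\bullet(X))$ with transition maps induced by inclusions; it is functorial in $X$ via $\langle x_0,\dots,x_n\rangle\mapsto\langle fx_0,\dots,fx_n\rangle$. Interleavings. For $M,N\colon([0,\infty),\le)\to\mathsf{Ab}$, an $\epsilon$-interleaving is a pair of families $\varphi_\ell\colon M\ell\to N(\ell+\epsilon)$, $\psi_\ell\colon N\ell\to M(\ell+\epsilon)$, natural in $\ell$, with $\psi_{\ell+\epsilon}\varphi_\ell=M(\ell\le\ell+2\epsilon)$ and $\varphi_{\ell+\epsilon}\psi_\ell=N(\ell\le\ell+2\epsilon)$; $d_I(M,N)$ is the infimum of all $\epsilon\in[0,\infty)$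 for which one exists ($\inf\varnothing=\infty$). *)

(* Defs.v *)
From HB Require Import structures.
From mathcomp.multinomials Require Import freeg.
From mathcomp Require Import all_boot all_order all_algebra.
From mathcomp Require Import boolp classical_sets functions cardinality reals.
From mathcomp Require Import interval_inference constructive_ereal ereal.

Set Implicit Arguments.
Unset Strict Implicit.
Unset Printing Implicit Defensive.
#[local] Obligation Tactic := idtac.

Import Order.TTheory GRing.Theory Num.Theory.

Local Open Scope classical_set_scope.
Local Open Scope ring_scope.

Declare Scope cat_scope.
Delimit Scope cat_scope with cat.

Record category := Category {
  obj :> Type;
  hom : obj -> obj -> Type;
  idm : forall a, hom a a;
  mcomp : forall a b c, hom b c -> hom a b -> hom a c;
  comp1m : forall a b (f : hom a b), mcomp (idm b) f = f;
  compm1 : forall a b (f : hom a b), mcomp f (idm a) = f;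
  compA : forall a b c d (h : hom c d) (g : hom b c) (f : hom a b),
    mcomp h (mcomp g f) = mcomp (mcomp h g) f }.

Arguments hom {_}.
Arguments idm {_}.
Arguments mcomp {_} [_ _ _].

Notation "g ∘ f" := (mcomp g f) (at level 40, left associativity) : cat_scope.
Local Open Scope cat_scope.

Record functor (C D : category) := Functor {
  fobj :> C -> D;
  fmor : forall a b, hom a b -> hom (fobj a) (fobj b);
  fmor1 : forall a, fmor (idm a) = idm (fobj a);
  fmorM : forall a b c (g : hom b c) (f : hom a b),
    fmor (g ∘ f) = fmor g ∘ fmor f }.

Arguments fmor {_ _} _ [_ _].

Record nattrans (C D : category) (F G : functor C D) := Nattrans {
  ncomp :> forall a, hom (F a) (G a);
  naturality : forall a b (f : hom a b),
    ncomp b ∘ fmor F f = fmor G f ∘ ncomp a }.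

Lemma nattrans_ext (C D : category) (F G : functor C D) (s t : nattrans F G) :
  (forall a, s a = t a) -> s = t.
Proof.
case: s t => [s sn] [t tn] /= st; have {}st : s = t by apply: functional_extensionality_dep.
by subst t; congr Nattrans; apply: Prop_irrelevance.
Qed.

Definition functor_id (C : category) : functor C C :=
  @Functor C C id (fun _ _ => id) (fun _ => erefl) (fun _ _ _ _ _ => erefl).

Program Definition functor_comp (C D E : category)
    (G : functor D E) (F : functor C D) : functor C E :=
  @Functor C E (fun a => G (F a)) (fun a b f => fmor G (fmor F f)) _ _.
Next Obligation. by move=> * /=; rewrite !fmor1. Qed.
Next Obligation. by move=> * /=; rewrite !fmorM. Qed.

Notation "G ∘F F" := (functor_comp G F) (at level 40, left associativity)
  : cat_scope.

Section FunctorCategory.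
Variables C D : category.

Program Definition nattrans_id (F : functor C D) : nattrans F F :=
  @Nattrans C D F F (fun a => idm (F a)) _.
Next Obligation. by move=> * /=; rewrite comp1m compm1. Qed.

Program Definition nattrans_comp (F G H : functor C D)
    (t : nattrans G H) (s : nattrans F G) : nattrans F H :=
  @Nattrans C D F H (fun a => t a ∘ s a) _.
Next Obligation.
by move=> F G H t s a b f /=; rewrite -compA naturality compA naturality compA.
Qed.

Program Definition functor_category : category :=
  @Category (functor C D) (@nattrans C D) nattrans_id nattrans_comp _ _ _.
Next Obligation. by move=> *; apply: nattrans_ext => a /=; rewrite comp1m. Qed.
Next Obligation. by move=> *; apply: nattrans_ext => a /=; rewrite compm1. Qed.
Next Obligation. by move=> *; apply: nattrans_ext => a /=; rewrite compA. Qed.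

End FunctorCategory.

Program Definition postcompose (C D E : category) (G : functor D E) :
    functor (functor_category C D) (functor_category C E) :=
  @Functor (functor_category C D) (functor_category C E)
    (fun F => G ∘F F)
    (fun F F' t => @Nattrans C E (G ∘F F) (G ∘F F') (fun a => fmor G (t a)) _)
    _ _.
Next Obligation. by move=> * /=; rewrite -!fmorM naturality. Qed.
Next Obligation. by move=> *; apply: nattrans_ext => a /=; rewrite fmor1. Qed.
Next Obligation. by move=> *; apply: nattrans_ext => a /=; rewrite fmorM. Qed.

Definition full_subcategory (C : category) (P : C -> Prop) : category :=
  @Category {a : C | P a} (fun a b => hom (sval a) (sval b))
    (fun a => idm (sval a)) (fun a b c g f => g ∘ f)
    (fun a b f => comp1m f) (fun a b f => compm1 f)
    (fun a b c d h g f => compA h g f).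

Definition full_inclusion (C : category) (P : C -> Prop) :
    functor (full_subcategory P) C :=
  @Functor (full_subcategory P) C sval (fun _ _ => id)
    (fun _ => erefl) (fun _ _ _ _ _ => erefl).

Definition poset_category d (P : porderType d) : category :=
  @Category P (fun x y => (x <= y)%O) (@lexx d P)
    (fun x y z yz xy => le_trans xy yz)
    (fun _ _ _ => bool_irrelevance _ _) (fun _ _ _ => bool_irrelevance _ _)
    (fun _ _ _ _ _ _ _ => bool_irrelevance _ _).

Record adjunction (C D : category) (F : functor C D) (G : functor D C) :=
  Adjunction {
  adj_unit : nattrans (functor_id C) (G ∘F F);
  adj_counit : nattrans (F ∘F G) (functor_id D);
  adj_triangleF : forall a : C,
    adj_counit (F a) ∘ fmor F (adj_unit a) = idm (F a);
  adj_triangleG : forall b : D,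
    fmor G (adj_counit b) ∘ adj_unit (G b) = idm (G b) }.

(* A left adjoint of G, as data; it is unique up to isomorphism only. *)
Record left_adjoint (C D : category) (G : functor D C) := LeftAdjoint {
  ladj :> functor C D;
  ladj_adjunction : adjunction ladj G }.

Record monad (C : category) := Monad {
  mfun :> functor C C;
  munit : nattrans (functor_id C) mfun;
  mmul : nattrans (mfun ∘F mfun) mfun;
  mmulA : forall a, mmul a ∘ fmor mfun (mmul a) = mmul a ∘ mmul (mfun a);
  mmul1m : forall a, mmul a ∘ munit (mfun a) = idm (mfun a);
  mmulm1 : forall a, mmul a ∘ fmor mfun (munit a) = idm (mfun a) }.

Definition monad_morphism (C : category) (S T : monad C) (q : nattrans S T) :=
  (forall a, q a ∘ munit S a = munit T a) /\
  (forall a, q a ∘ mmul S a = mmul T a ∘ (q (T a) ∘ fmor S (q a))).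

Program Definition induced_monad (C D : category) (G : functor D C)
    (F : left_adjoint G) : monad C :=
  let adj := ladj_adjunction F in
  @Monad C (G ∘F F) (adj_unit adj)
    (@Nattrans C C ((G ∘F F) ∘F (G ∘F F)) (G ∘F F)
       (fun a => fmor G (adj_counit adj (F a))) _) _ _ _.
Next Obligation.
move=> C D G F adj a b f /=; rewrite -!fmorM; congr (fmor G _).
exact: (naturality (adj_counit adj) (fmor F f)).
Qed.
Next Obligation.
move=> C D G F adj a /=; rewrite -!fmorM; congr (fmor G _).
exact: (naturality (adj_counit adj) (adj_counit adj (F a))).
Qed.
Next Obligation. by move=> C D G F adj a /=; exact: adj_triangleG. Qed.
Next Obligation.
by move=> C D G F adj a /=; rewrite -fmorM adj_triangleF fmor1.
Qed.

Section Met.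
Variable R : realType.

(* Distances lie in [0, +oo], as a part of the extended reals. *)
Record emetric := EMetric {
  carrier :> Type;
  dist : carrier -> carrier -> \bar R;
  dist_ge0 : forall x y, (0 <= dist x y)%E;
  dist_xx : forall x, dist x x = 0%E;
  dist_sym : forall x y, dist x y = dist y x;
  dist_triangle : forall x y z, (dist x z <= dist x y + dist y z)%E;
  dist_eq0 : forall x y, dist x y = 0%E -> x = y }.

Record nonexpansive (X Y : emetric) := Nonexpansive {
  nefun :> X -> Y;
  nefun_le : forall x y, (dist (nefun x) (nefun y) <= dist x y)%E }.

Lemma nonexpansive_ext (X Y : emetric) (f g : nonexpansive X Y) :
  f =1 g -> f = g.
Proof.
case: f g => [f fn] [g gn] /= /funext fg; subst g.
by congr Nonexpansive; apply: Prop_irrelevance.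
Qed.

Program Definition Met : category :=
  @Category emetric nonexpansive (fun X => @Nonexpansive X X id _)
    (fun X Y Z g f => @Nonexpansive X Z (g \o f) _) _ _ _.
Next Obligation. by move=> X x y. Qed.
Next Obligation.
by move=> X Y Z g f x y /=; exact: le_trans (nefun_le g _ _) (nefun_le f _ _).
Qed.
Next Obligation. by move=> *; exact: nonexpansive_ext. Qed.
Next Obligation. by move=> *; exact: nonexpansive_ext. Qed.
Next Obligation. by move=> *; exact: nonexpansive_ext. Qed.

End Met.

Arguments dist {_ _}.

Record signature := Signature { op :> finType; ar : op -> nat }.
Arguments ar {_}.

Inductive term (Sg : signature) (V : Type) :=
| Var of V
| App (f : Sg) of ('I_(ar f) -> term Sg V).
Arguments Var {Sg V}.
Arguments App {Sg V}.

Fixpoint term_fold (Sg : signature) (V A : Type)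
    (opA : forall f : Sg, ('I_(ar f) -> A) -> A) (iota : V -> A)
    (t : term Sg V) : A :=
  match t with
  | Var x => iota x
  | App f ts => opA f (fun i => term_fold opA iota (ts i))
  end.

Section Theories.
Variable Sg : signature.

(* The fixed countably infinite set of variables is taken to be nat. *)
Let T := term Sg nat.

Definition subst (sigma : nat -> T) : T -> T := term_fold (@App Sg nat) sigma.

Record qeq := QEq { lhs : T; eps : {nonneg rat}; rhs : T }.

Definition subst_qeq (sigma : nat -> T) (e : qeq) : qeq :=
  QEq (subst sigma (lhs e)) (eps e) (subst sigma (rhs e)).

(* A pair (G, p) stands for the inference with premises G and conclusion p. *)
Definition inferences : set (set qeq * qeq) := [set i | finite_set i.1].

Definition basic (i : set qeq * qeq) : Prop :=
  i.1 `<=` [set e | exists x y : nat, lhs e = Var x /\ rhs e = Var y].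

Record deducibility_relation (D : set qeq -> qeq -> Prop) : Prop := {
  ded_refl : forall t, D set0 (QEq t 0%:nng t);
  ded_sym : forall t e s, D [set QEq t e s] (QEq s e t);
  ded_triangle : forall t s u e e',
    D [set QEq t e s; QEq s e' u] (QEq t (e%:num + e'%:num)%:nng u);
  ded_max : forall t s (e e' : {nonneg rat}), 0 < e'%:num ->
    D [set QEq t e s] (QEq t (e%:num + e'%:num)%:nng s);
  ded_arch : forall t s e,
    D [set QEq t e' s | e' in [set e' : {nonneg rat} | e < e']] (QEq t e s);
  ded_nexp : forall (f : Sg) (t s : 'I_(ar f) -> T) e,
    D (range (fun i => QEq (t i) e (s i))) (QEq (App f t) e (App f s));
  ded_subst : forall (sigma : nat -> T) G p,
    D G p -> D (subst_qeq sigma @` G) (subst_qeq sigma p);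
  ded_cut : forall G G' p, (forall p', G' p' -> D G p') -> D G' p -> D G p;
  ded_assum : forall (G : set qeq) p, G p -> D G p }.

Definition deducible (S : set (set qeq * qeq)) (G : set qeq) (p : qeq) : Prop :=
  forall D, deducibility_relation D -> (forall i, S i -> D i.1 i.2) -> D G p.

Definition induced_theory (S : set (set qeq * qeq)) : set (set qeq * qeq) :=
  [set i | deducible S i.1 i.2] `&` inferences.

Definition quantitative_theory (U : set (set qeq * qeq)) : Prop :=
  exists S, [/\ S `<=` inferences, (forall i, S i -> basic i) &
                U = induced_theory S].

End Theories.

Section Algebras.
Variables (R : realType) (Sg : signature).

Record qalgebra := QAlgebra {
  qspace :> emetric R;
  qop : forall f : Sg, ('I_(ar f) -> qspace) -> qspace;
  qop_nexp : forall (f : Sg) (a b : 'I_(ar f) -> qspace) (e : {nonneg R}),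
    (forall i, (dist (a i) (b i) <= e%:num%:E)%E) ->
    (dist (qop (f := f) a) (qop (f := f) b) <= e%:num%:E)%E }.

Arguments qop {_} _ _.

Definition teval (A : qalgebra) (iota : nat -> A) : term Sg nat -> A :=
  term_fold (@qop A) iota.

Definition holds (A : qalgebra) (iota : nat -> A) (e : qeq Sg) : Prop :=
  (dist (teval iota (lhs e)) (teval iota (rhs e)) <= (ratr (eps e)%:num)%:E)%E.

Definition satisfies (A : qalgebra) (i : set (qeq Sg) * qeq Sg) : Prop :=
  forall iota : nat -> A,
    (forall e, i.1 e -> holds iota e) -> holds iota i.2.

Record qalg_hom (A B : qalgebra) := QAlgHom {
  qhom :> nonexpansive A B;
  qhom_op : forall (f : Sg) (a : 'I_(ar f) -> A),
    qhom (qop f a) = qop f (fun i => qhom (a i)) }.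

Lemma qalg_hom_ext (A B : qalgebra) (f g : qalg_hom A B) : f =1 g -> f = g.
Proof.
case: f g => [f fn] [g gn] /= /nonexpansive_ext fg; subst g.
by congr QAlgHom; apply: Prop_irrelevance.
Qed.

Program Definition QAlg : category :=
  @Category qalgebra qalg_hom (fun A => @QAlgHom A A (idm (A : Met R)) _)
    (fun A B C g f =>
       @QAlgHom A C (@mcomp (Met R) A B C g f) _) _ _ _.
Next Obligation. by []. Qed.
Next Obligation. by move=> A B C g f h a /=; rewrite !qhom_op. Qed.
Next Obligation. by move=> *; exact: qalg_hom_ext. Qed.
Next Obligation. by move=> *; exact: qalg_hom_ext. Qed.
Next Obligation. by move=> *; exact: qalg_hom_ext. Qed.

Definition qalg_forget : functor QAlg (Met R) :=
  @Functor QAlg (Met R) qspace (fun A B f => qhom f)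
    (fun _ => erefl) (fun _ _ _ _ _ => erefl).

Definition is_model (U : set (set (qeq Sg) * qeq Sg)) (A : QAlg) : Prop :=
  forall i, U i -> satisfies A i.

Definition Mod (U : set (set (qeq Sg) * qeq Sg)) : category :=
  full_subcategory (is_model U).

Definition forget (U : set (set (qeq Sg) * qeq Sg)) : functor (Mod U) (Met R) :=
  qalg_forget ∘F full_inclusion (is_model U).

Lemma is_model_sub (U U' : set (set (qeq Sg) * qeq Sg)) (A : QAlg) :
  U `<=` U' -> is_model U' A -> is_model U A.
Proof. by move=> UU' mA i /UU'; exact: mA. Qed.

Definition Mod_inclusion (U U' : set (set (qeq Sg) * qeq Sg)) (UU' : U `<=` U')
    : functor (Mod U') (Mod U) :=
  @Functor (Mod U') (Mod U)
    (fun A => exist _ (sval A) (is_model_sub UU' (svalP A)))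
    (fun _ _ => id) (fun _ => erefl) (fun _ _ _ _ _ => erefl).

End Algebras.

Arguments Mod R {Sg} U.
Arguments forget R {Sg} U.
Arguments is_model {R Sg} U A.
Arguments Mod_inclusion {R Sg U U'} UU'.
(* The left adjoint of forget exists: the free model on X consists of the terms
   over X modulo distance 0, where the distance of two terms is the supremum of
   the distances of their values over all nonexpansive maps from X to models. *)
Section FreeModel.
Variables (R : realType) (Sg : signature) (U : set (set (qeq Sg) * qeq Sg)).

Section Construction.
Variable X : emetric R.
Let T := term Sg X.

Definition term_ext (B : Mod R U) (f : nonexpansive X (forget R U B)) : T -> sval B :=
  term_fold (@qop _ _ (sval B)) f.

Definition term_dist (t s : T) : \bar R :=
  ereal_sup [set r | r = 0%E \/
    exists (B : Mod R U) (f : nonexpansive X (forget R U B)),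
      r = dist (term_ext f t) (term_ext f s)].

Lemma term_dist_ge0 t s : (0 <= term_dist t s)%E.
Proof. by apply: ereal_sup_ubound; left. Qed.

Lemma term_dist_le t s (r : \bar R) :
  (term_dist t s <= r)%E <-> (0 <= r)%E /\
  forall (B : Mod R U) (f : nonexpansive X (forget R U B)),
    (dist (term_ext f t) (term_ext f s) <= r)%E.
Proof.
split=> [tr|[r0 tr]].
  split=> [|B f]; first exact: le_trans (term_dist_ge0 t s) tr.
  by apply: le_trans tr; apply: ereal_sup_ubound; right; exists B, f.
by apply: ge_ereal_sup => _ [->|[B [f ->]]].
Qed.

Lemma le_term_dist t s (B : Mod R U) (f : nonexpansive X (forget R U B)) :
  (dist (term_ext f t) (term_ext f s) <= term_dist t s)%E.
Proof. by have [/(_ (lexx _))[]] := term_dist_le t s (term_dist t s). Qed.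

Lemma term_dist_xx t : term_dist t t = 0%E.
Proof.
apply/eqP; rewrite eq_le term_dist_ge0 andbT; apply/term_dist_le.
by split=> // B f; rewrite dist_xx.
Qed.

Lemma term_dist_sym t s : term_dist t s = term_dist s t.
Proof.
by apply/eqP; rewrite eq_le; apply/andP; split; apply/term_dist_le;
  (split=> [|B f]; [exact: term_dist_ge0|rewrite dist_sym; exact: le_term_dist]).
Qed.

Lemma term_dist_triangle t s u :
  (term_dist t u <= term_dist t s + term_dist s u)%E.
Proof.
apply/term_dist_le; split=> [|B f]; first by rewrite adde_ge0 ?term_dist_ge0.
by apply: le_trans (dist_triangle _ (term_ext f s) _) _; rewrite leeD ?le_term_dist.
Qed.

Lemma term_dist_eq t t' s s' :
  term_dist t t' = 0%E -> term_dist s s' = 0%E -> term_dist t s = term_dist t' s'.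
Proof.
have H a a' b b' : term_dist a a' = 0%E -> term_dist b b' = 0%E ->
    (term_dist a b <= term_dist a' b')%E.
  move=> aa bb; apply: le_trans (term_dist_triangle _ a' _) _; rewrite aa add0e.
  by apply: le_trans (term_dist_triangle _ b' _) _; rewrite (term_dist_sym b') bb adde0.
by move=> tt' ss'; apply/eqP; rewrite eq_le !H // term_dist_sym.
Qed.

Definition free_carrier : Type :=
  {P : set T | exists t, P = [set s | term_dist t s = 0%E]}.

Definition free_class (t : T) : free_carrier := exist _ _ (ex_intro _ t erefl).

Definition free_repr (c : free_carrier) : T := sval (cid (svalP c)).

Lemma free_reprK c : free_class (free_repr c) = c.
Proof.
have := svalP (cid (svalP c)); rewrite -/(free_repr c); move: (free_repr c) => t.
by case: c => P Pt /= PE; exact/eq_exist/esym.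
Qed.

Lemma free_class_repr t : term_dist t (free_repr (free_class t)) = 0%E.
Proof.
rewrite /free_repr; case: cid => s /= /(congr1 (fun P : set T => P s)) /= ->.
exact: term_dist_xx.
Qed.

Program Definition free_space : emetric R :=
  @EMetric R free_carrier (fun c d => term_dist (free_repr c) (free_repr d))
    _ _ _ _ _.
Next Obligation. by move=> *; exact: term_dist_ge0. Qed.
Next Obligation. by move=> *; exact: term_dist_xx. Qed.
Next Obligation. by move=> *; exact: term_dist_sym. Qed.
Next Obligation. by move=> *; exact: term_dist_triangle. Qed.
Next Obligation.
move=> c d cd; rewrite -(free_reprK c) -(free_reprK d); apply: eq_exist.
by apply/funext => s /=; rewrite (term_dist_eq cd (term_dist_xx s)).
Qed.

Lemma free_dist (t s : T) :
  dist (free_class t : free_space) (free_class s : free_space) = term_dist t s.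
Proof. by apply/esym/term_dist_eq; exact: free_class_repr. Qed.

Program Definition free_algebra : qalgebra R Sg :=
  @QAlgebra R Sg free_space
    (fun f a => free_class (App f (fun i => free_repr (a i)))) _.
Next Obligation.
move=> f a b e ab; rewrite free_dist; apply/term_dist_le.
split=> [|B g]; first by rewrite lee_fin.
apply: qop_nexp => i; apply: le_trans (ab i); exact: le_term_dist.
Qed.

Lemma term_ext_class (B : Mod R U) (f : nonexpansive X (forget R U B)) t :
  term_ext f (free_repr (free_class t)) = term_ext f t.
Proof.
apply: dist_eq0; apply/eqP; rewrite dist_sym eq_le dist_ge0 andbT.
by rewrite -(free_class_repr t) le_term_dist.
Qed.

Program Definition free_hom (B : Mod R U) (f : nonexpansive X (forget R U B)) :
    qalg_hom free_algebra (sval B) :=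
  @QAlgHom R Sg free_algebra (sval B)
    (@Nonexpansive R free_algebra (sval B) (fun c => term_ext f (free_repr c)) _) _.
Next Obligation. by move=> B f c d; exact: le_term_dist. Qed.
Next Obligation. by move=> B f g a /=; rewrite term_ext_class. Qed.

Lemma qalg_hom_teval (A B : qalgebra R Sg) (h : qalg_hom A B) (iota : nat -> A) t :
  h (teval iota t) = teval (h \o iota) t.
Proof.
elim: t => [//|f ts IH] /=; rewrite qhom_op; congr qop; apply/funext => i.
exact: IH.
Qed.

Lemma free_is_model : is_model U free_algebra.
Proof.
move=> i Ui iota iG; apply/term_dist_le.
split=> [|B f]; first by rewrite lee_fin ler0q.
have H t : term_ext f (free_repr (teval iota t)) = teval (free_hom f \o iota) t.
  by rewrite -qalg_hom_teval.
rewrite !H; apply: (svalP B i Ui) => e /iG; rewrite /holds -!qalg_hom_teval.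
exact: le_trans (nefun_le _ _ _).
Qed.

Definition free_model : Mod R U := exist _ free_algebra free_is_model.

Program Definition free_unit : nonexpansive X free_algebra :=
  @Nonexpansive R X free_algebra (fun x => free_class (Var x)) _.
Next Obligation.
move=> x y; rewrite free_dist; apply/term_dist_le.
by split=> [|B f]; [exact: dist_ge0|exact: nefun_le].
Qed.

Lemma free_hom_unit (B : Mod R U) (f : nonexpansive X (forget R U B)) x :
  free_hom f (free_unit x) = f x.
Proof. by rewrite /= term_ext_class. Qed.

Lemma free_hom_eq (B : qalgebra R Sg) (h k : qalg_hom free_algebra B) :
  (forall x, h (free_unit x) = k (free_unit x)) -> h = k.
Proof.
move=> hk; apply: qalg_hom_ext => c; rewrite -(free_reprK c).
elim: (free_repr c) => [x|f ts IH]; first exact: hk.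
have -> : free_class (App f ts) =
    @qop _ _ free_algebra f (fun i => free_class (ts i)).
  apply: (@dist_eq0 _ free_space); rewrite free_dist; apply/eqP.
  rewrite eq_le term_dist_ge0 andbT; apply/term_dist_le; split=> // B' g.
  have -> : term_ext g (App f (fun i => free_repr (free_class (ts i)))) =
            term_ext g (App f ts).
    rewrite /term_ext /=; congr qop; apply/funext => i; exact: term_ext_class.
  by rewrite dist_xx.
by rewrite !qhom_op; congr qop; apply/funext => i.
Qed.

End Construction.

Program Definition free_functor : functor (Met R) (Mod R U) :=
  @Functor (Met R) (Mod R U) free_model
    (fun X Y f => @free_hom X (free_model Y)
       (@mcomp (Met R) X Y (free_algebra Y) (free_unit Y) f)) _ _.
Next Obligation.
by move=> X; apply: free_hom_eq => x; rewrite free_hom_unit.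
Qed.
Next Obligation.
move=> X Y Z g f; apply: free_hom_eq => x; rewrite free_hom_unit.
by rewrite [RHS](congr1 _ (free_hom_unit _ _)) free_hom_unit.
Qed.

Program Definition free_adjunction : adjunction free_functor (forget R U) :=
  @Adjunction (Met R) (Mod R U) free_functor (forget R U)
    (@Nattrans (Met R) (Met R) (functor_id _) (forget R U ∘F free_functor)
       free_unit _)
    (@Nattrans (Mod R U) (Mod R U) (free_functor ∘F forget R U) (functor_id _)
       (fun B => @free_hom (forget R U B) B (idm (forget R U B))) _) _ _.
Next Obligation.
by move=> X Y f; apply: nonexpansive_ext => x /=; rewrite term_ext_class.
Qed.
Next Obligation.
move=> A B f; apply: free_hom_eq => x /=; by rewrite !term_ext_class.
Qed.
Next Obligation.
move=> X; apply: free_hom_eq => x /=.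
by rewrite term_ext_class /= term_ext_class.
Qed.
Next Obligation.
by move=> B; apply: nonexpansive_ext => x /=; rewrite term_ext_class.
Qed.

Definition free_left_adjoint : left_adjoint (forget R U) :=
  LeftAdjoint free_adjunction.

End FreeModel.

Lemma additive_ext (A B : zmodType) (f g : {additive A -> B}) :
  f =1 g -> f = g.
Proof.
case: f g => [f [[fc]]] [g [[gc]]] /= /funext fg; subst g.
by rewrite (Prop_irrelevance fc gc).
Qed.
Program Definition Ab : category :=
  @Category zmodType (fun A B => {additive A -> B})
    (fun A => [the {additive A -> A} of idfun])
    (fun A B C g f => [the {additive A -> C} of g \o f]) _ _ _.
Next Obligation. by move=> *; exact: additive_ext. Qed.
Next Obligation. by move=> *; exact: additive_ext. Qed.
Next Obligation. by move=> *; exact: additive_ext. Qed.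

Record chain_complex := ChainComplex {
  chain :> nat -> zmodType;
  bd : forall n, {additive chain n.+1 -> chain n};
  bd_bd : forall n (c : chain n.+2), bd n (bd n.+1 c) = 0 }.
Arguments bd {_} _.

Record chain_map (C D : chain_complex) := ChainMap {
  cmap :> forall n, {additive C n -> D n};
  cmap_bd : forall n (c : C n.+1), cmap n (bd n c) = bd n (cmap n.+1 c) }.

Lemma chain_map_ext (C D : chain_complex) (f g : chain_map C D) :
  (forall n, f n =1 g n) -> f = g.
Proof.
case: f g => [f fc] [g gc] /= fg.
have {}fg : f = g.
  by apply: functional_extensionality_dep => n; exact: additive_ext (fg n).
by subst g; congr ChainMap; apply: Prop_irrelevance.
Qed.

Program Definition Ch : category :=
  @Category chain_complex chain_map
    (fun C => @ChainMap C C (fun n => idm (C n : Ab)) _)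
    (fun C D E g f =>
       @ChainMap C E (fun n => @mcomp Ab (C n) (D n) (E n) (g n) (f n)) _) _ _ _.
Next Obligation. by []. Qed.
Next Obligation. by move=> C D E g f n c /=; rewrite !cmap_bd. Qed.
Next Obligation. by move=> *; exact: chain_map_ext. Qed.
Next Obligation. by move=> *; exact: chain_map_ext. Qed.
Next Obligation. by move=> *; exact: chain_map_ext. Qed.

Section Homology.
Variables (C : chain_complex) (n : nat).

(* The boundary out of degree 0 is the zero map. *)
Definition is_cycle : {pred C n} :=
  match n return C n -> bool with
  | 0 => fun=> true
  | m.+1 => fun c => bd m c == 0
  end.

Lemma is_cycle_zmod_closed : zmod_closed is_cycle.
Proof.
rewrite /is_cycle; case: n => [|m]; split; rewrite ?unfold_in //=.
  by rewrite raddf0.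
by move=> x y; rewrite !unfold_in raddfB => /eqP-> /eqP->; rewrite subr0.
Qed.
HB.instance Definition _ :=
  GRing.isZmodClosed.Build (C n) is_cycle is_cycle_zmod_closed.

Record hcycle := HCycle { hcycle_val :> C n; hcycleP : hcycle_val \in is_cycle }.
HB.instance Definition _ := [isSub for hcycle_val].
HB.instance Definition _ := [Choice of hcycle by <:].
HB.instance Definition _ := [SubChoice_isSubZmodule of hcycle by <:].

Definition is_boundary : {pred hcycle} :=
  fun z => `[< exists c : C n.+1, bd n c = val z >].

Lemma is_boundary_zmod_closed : zmod_closed is_boundary.
Proof.
split=> [|x y /asboolP[a ax] /asboolP[b by_]]; apply/asboolP.
  by exists 0; rewrite raddf0.
by exists (a - b); rewrite !raddfB/= ax by_.
Qed.
HB.instance Definition _ :=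
  GRing.isZmodClosed.Build hcycle is_boundary is_boundary_zmod_closed.

Definition homology : zmodType := Quotient.quot is_boundary.

Definition hclass (z : hcycle) : homology := (\pi z)%qT.

End Homology.

Arguments is_cycle : clear implicits.
Arguments hcycle : clear implicits.
Arguments hclass {C n}.

Lemma hclass_surj (C : chain_complex) n (h : homology C n) :
  exists z, h = hclass z.
Proof. by exists (repr h); rewrite /hclass reprK. Qed.

Lemma hclass_eq (C : chain_complex) n (y z : hcycle C n) :
  hclass y = hclass z <-> exists c : C n.+1, bd n c = val y - val z.
Proof.
split=> [/eqP|yz].
  rewrite /hclass -Quotient.idealrBE => /asboolP[c bc].
  by exists c; rewrite bc raddfB.
by apply/eqP; rewrite /hclass -Quotient.idealrBE; apply/asboolP.
Qed.

Section HomologyMap.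
Variables (C D : chain_complex) (f : chain_map C D) (n : nat).

Lemma cmap_cycle (z : hcycle C n) : f n (val z) \in is_cycle D n.
Proof.
case: z => /= c; rewrite !unfold_in /is_cycle; move: c; case: n => //= m c /eqP bc.
by rewrite -cmap_bd bc raddf0.
Qed.

Definition hcycle_map (z : hcycle C n) : hcycle D n := HCycle (cmap_cycle z).

Definition homology_map_fun (h : homology C n) : homology D n :=
  hclass (hcycle_map (repr h)).

Lemma homology_map_hclass (z : hcycle C n) :
  homology_map_fun (hclass z) = hclass (hcycle_map z).
Proof.
apply/hclass_eq; have /hclass_eq[c bc] : hclass (repr (hclass z)) = hclass z.
  by rewrite /hclass reprK.
by exists (f n.+1 c); rewrite -cmap_bd bc raddfB.
Qed.

Lemma homology_map_is_additive : zmod_morphism homology_map_fun.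
Proof.
move=> h k; have [[y ->] [z ->]] := (hclass_surj h, hclass_surj k).
have hB (E : chain_complex) (u v : hcycle E n) :
  hclass (u - v) = hclass u - hclass v by rewrite /hclass raddfB.
rewrite -hB !homology_map_hclass -hB; congr hclass.
by apply: val_inj; rewrite /= !raddfB.
Qed.
HB.instance Definition _ :=
  GRing.isZmodMorphism.Build (homology C n) (homology D n) homology_map_fun
    homology_map_is_additive.

Definition homology_map : {additive homology C n -> homology D n} :=
  homology_map_fun.

End HomologyMap.

Program Definition Hlgy (n : nat) : functor Ch Ab :=
  @Functor Ch Ab (fun C => homology C n) (fun C D f => homology_map f n) _ _.
Next Obligation.
move=> n C; apply: additive_ext => h /=; have [z ->] := hclass_surj h.
by rewrite homology_map_hclass; congr hclass; apply: val_inj.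
Qed.
Next Obligation.
move=> n C D E g f; apply: additive_ext => h /=; have [z ->] := hclass_surj h.
by rewrite !homology_map_hclass; congr hclass; apply: val_inj.
Qed.
Section FreeAbelianGroup.
Variable K : choiceType.

HB.instance Definition _ (M : lmodType int) (f : K -> M) :=
  GRing.isZmodMorphism.Build {freeg K} M (fglift f) (lift_is_additive f).

Lemma freeg_gen (P : {freeg K} -> Prop) :
  P 0 -> (forall x y, P x -> P y -> P (x - y)) -> (forall k, P << k >>) ->
  forall c, P c.
Proof.
move=> P0 PB Pg c.
have PN x : P x -> P (- x) by move=> Px; rewrite -sub0r; exact: PB.
have PD x y : P x -> P y -> P (x + y).
  by move=> Px Py; rewrite -[y]opprK; apply: PB => //; exact: PN.
have PM x n : P x -> P (x *+ n).
  by move=> Px; elim: n => [|n IH]; rewrite ?mulr0n // mulrS; exact: PD.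
rewrite -(freeg_sumE c); elim/big_ind: _ => // k _.
rewrite -[coeff k c]intz -freegU_mulz; case: (coeff k c) => m.
  exact: PM.
by rewrite NegzE mulrNz; apply: PN; exact: PM.
Qed.

Lemma freeg_additive_eq (G : zmodType) (f g : {additive {freeg K} -> G}) :
  (forall k, f << k >> = g << k >>) -> f =1 g.
Proof.
move=> fg; apply: freeg_gen => [|x y fx fy|k]; first by rewrite !raddf0.
  by rewrite !raddfB fx fy.
exact: fg.
Qed.

End FreeAbelianGroup.

Section Nerve.
Variables (X : Type).

(* <x_0, ..., x_n> is encoded as the map i |-> x_i on 'I_n.+1. *)
Definition simplex n := 'I_n.+1 -> X.

Definition face n (i : 'I_n.+2) (x : simplex n.+1) : simplex n :=
  fun j => x (lift i j).

Definition vtx_src n (i : 'I_n) : 'I_n.+1 := widen_ord (leqnSn n) i.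
Definition vtx_tgt n (i : 'I_n) : 'I_n.+1 := lift ord0 i.

Definition nondegenerate n (x : simplex n) : bool :=
  `[< forall i : 'I_n, x (vtx_src i) <> x (vtx_tgt i) >].

Definition nd_simplex n := {classic {x : simplex n | nondegenerate x}}.

Definition nchain n := {freeg nd_simplex n}.

(* The image of a simplex in the normalised chains: 0 if it is degenerate. *)
Definition nclass n (x : simplex n) : nchain n :=
  if insub x is Some s then << (s : nd_simplex n) >> else 0.

Definition nbd n : {additive nchain n.+1 -> nchain n} :=
  fglift (fun s : nd_simplex n.+1 =>
    \sum_(i < n.+2) (-1) ^+ i *: nclass (face i (val s))).

Arguments nbd {n}.

Lemma nclass_val n (s : nd_simplex n) : nclass (val s) = << s >>.
Proof. by rewrite /nclass valK. Qed.

Lemma nclass_degenerate n (x : simplex n) (i : 'I_n) :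
  x (vtx_src i) = x (vtx_tgt i) -> nclass x = 0.
Proof.
move=> xi; rewrite /nclass insubN //; apply/negP => /asboolP nd.
exact: nd xi.
Qed.

Lemma face_same n (x : simplex n.+1) (k : 'I_n.+1) :
  x (vtx_src k) = x (vtx_tgt k) -> face (vtx_src k) x = face (vtx_tgt k) x.
Proof.
move=> xk; apply/funext => j; rewrite /face.
have [->|jk] := eqVneq j k.
  have -> : lift (vtx_src k) k = vtx_tgt k.
    by apply: val_inj; rewrite /= /bump leqnn.
  have -> // : lift (vtx_tgt k) k = vtx_src k.
  by apply: val_inj; rewrite /= /bump /= add1n ltnn.
congr x; apply: val_inj; rewrite /= /bump /= add1n.
by congr (_ + _)%N; rewrite ltn_neqAle eq_sym (negbTE jk : (val j == val k) = false).
Qed.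

Lemma face_degenerate n (x : simplex n.+1) (k : 'I_n.+1) (i : 'I_n.+2) :
  x (vtx_src k) = x (vtx_tgt k) -> i != vtx_src k -> i != vtx_tgt k ->
  nclass (face i x) = 0.
Proof.
move=> xk; rewrite -!val_eqE /= /bump /= add1n => ik ik1.
have [ltik|leki] := ltnP i k.
  have kn : (k.-1 < n)%N.
    by rewrite prednK ?(leq_ltn_trans _ ltik)// -ltnS ltn_ord.
  apply: (@nclass_degenerate _ _ (Ordinal kn)).
  have k0 : (0 < k)%N by exact: leq_ltn_trans ltik.
  rewrite /face.
  have -> : lift i (vtx_src (Ordinal kn)) = vtx_src k.
    apply: val_inj; rewrite /= /bump /=.
    by rewrite -ltnS prednK // ltik add1n prednK.
  have -> // : lift i (vtx_tgt (Ordinal kn)) = vtx_tgt k.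
  apply: val_inj; rewrite /= /bump /= !add1n prednK //.
  by rewrite (ltnW ltik).
have k1i : (k.+1 < i)%N by rewrite !ltn_neqAle eq_sym ik1 eq_sym ik.
have kn : (k < n)%N by rewrite -ltnS (leq_trans k1i) // -ltnS.
apply: (@nclass_degenerate _ _ (Ordinal kn)); rewrite /face.
have -> : lift i (vtx_src (Ordinal kn)) = vtx_src k.
  by apply: val_inj; rewrite /= /bump leqNgt (ltnW k1i).
have -> // : lift i (vtx_tgt (Ordinal kn)) = vtx_tgt k.
by apply: val_inj; rewrite /= /bump /= leqNgt !add1n k1i.
Qed.

Lemma nbd_nclass n (x : simplex n.+1) :
  nbd (nclass x) = \sum_(i < n.+2) (-1) ^+ i *: nclass (face i x).
Proof.
have [nd|/negP dg] := boolP (nondegenerate x).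
  by rewrite (_ : x = val (exist _ x nd : nd_simplex n.+1)) // nclass_val
             /nbd /= liftU scale1r.
have [k xk] : exists k : 'I_n.+1, x (vtx_src k) = x (vtx_tgt k).
  by apply: contrapT => /forallNP nk; apply: dg; apply/asboolP.
rewrite (nclass_degenerate xk) raddf0 (bigD1 (vtx_src k)) //=.
rewrite (bigD1 (vtx_tgt k)) /=; last first.
  by rewrite -val_eqE /= /bump /= add1n gtn_eqF.
rewrite big1 => [|i /andP[ik ik1]]; last first.
  by rewrite (face_degenerate xk) // scaler0.
by rewrite addr0 (face_same xk) /bump /= add1n exprS mulN1r scaleNr subrr.
Qed.

Lemma face_face n (x : simplex n.+2) (i : 'I_n.+3) (j : 'I_n.+2) :
  (i <= j)%N ->
  face j (face i x) = face (inord i) (face (lift ord0 j) x).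
Proof.
move=> ij; apply/funext => k; rewrite /face; congr x; apply: val_inj => /=.
rewrite inordK ?(leq_ltn_trans ij) // /bump /= add1n.
case: (leqP j k) => jk; case: (leqP i k) => ik /=; rewrite ?add0n ?add1n.
- by rewrite (leqW ik) ltnS jk.
- by move: ik; rewrite ltnNge (leq_trans ij jk).
- by rewrite ltnNge jk.
- by rewrite ltnNge (ltnW jk).
Qed.

Lemma additive_signZ (V W : lmodType int) (f : {additive V -> W}) i v :
  f ((-1) ^+ i *: v) = (-1) ^+ i *: f v.
Proof. by rewrite -signr_odd; case: odd; rewrite ?scaleN1r ?scale1r ?raddfN. Qed.

Lemma nbd_nbd n (c : nchain n.+2) : nbd (nbd c) = 0.
Proof.
move: c; apply: freeg_gen => [|x y bx by_|s]; first by rewrite !raddf0.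
  by rewrite !raddfB /= bx by_ subrr.
rewrite -nclass_val nbd_nclass raddf_sum /=.
pose F (p : 'I_n.+3 * 'I_n.+2) : nchain n :=
  (-1) ^+ (p.1 + p.2)%N *: nclass (face p.2 (face p.1 (val s))).
transitivity (\sum_p F p).
  rewrite -(eq_bigr _ (fun p _ => congr1 F (esym (surjective_pairing p)))).
  rewrite -(pair_bigA _ (fun i j => F (i, j))); apply: eq_bigr => i _.
  rewrite additive_signZ nbd_nclass scaler_sumr; apply: eq_bigr => j _.
  by rewrite /F /= exprD scalerA.
pose h (p : 'I_n.+3 * 'I_n.+2) : 'I_n.+3 * 'I_n.+2 :=
  (fintype.lift ord0 p.2, inord p.1).
pose h' (p : 'I_n.+3 * 'I_n.+2) : 'I_n.+3 * 'I_n.+2 :=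
  (widen_ord (leqnSn _) p.2, inord p.1.-1).
rewrite (bigID (fun p : 'I_n.+3 * 'I_n.+2 => p.1 <= p.2)%N) /=.
apply/eqP; rewrite addrC addr_eq0 -sumrN; apply/eqP.
rewrite (reindex_onto h h') /=; last first.
  case=> i j /=; rewrite -ltnNge => ji; have i0 : (0 < i)%N by exact: leq_ltn_trans ji.
  have iK : (i.-1 < n.+2)%N by rewrite prednK // -ltnS.
  by congr pair; apply: val_inj; rewrite /= inordK //= /bump /= add1n prednK.
have hE (i : 'I_n.+3) (j : 'I_n.+2) :
    ~~ (lift ord0 j <= (inord i : 'I_n.+2))%N && (h' (h (i, j)) == (i, j))
    = (i <= j)%N.
  rewrite -ltnNge /h' /h /= /bump /= add1n; apply/andP/idP => [[ij]|ij].
    by rewrite xpair_eqE -val_eqE /= => /andP[/eqP iE _]; rewrite -iE.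
  have iK : (i < n.+2)%N by exact: leq_ltn_trans ij _.
  rewrite inordK // ltnS; split => //; apply/eqP; congr pair; apply: val_inj.
    by rewrite /= inordK.
  by rewrite add0n inord_val.
apply: eq_big => [[i j]|[i j]]; first by rewrite /= -hE.
rewrite hE => ij; rewrite /F /= [in RHS]face_face // inordK ?(leq_ltn_trans ij) //.
by rewrite /bump /= add1n addSn exprS mulN1r scaleNr addnC.
Qed.
End Nerve.

Arguments nbd {X n}.
Arguments nclass {X n} x.

Section NerveMap.
Variables (X Y : Type) (f : X -> Y).

Definition nmap n : {additive nchain X n -> nchain Y n} :=
  fglift (fun s : nd_simplex X n => nclass (f \o val s)).

Lemma nmap_nclass n (x : simplex X n) : nmap n (nclass x) = nclass (f \o x).
Proof.
have [nd|/negP dg] := boolP (nondegenerate x).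
  by rewrite (_ : x = val (exist _ x nd : nd_simplex X n)) // nclass_val
             /nmap /= liftU scale1r.
have [k xk] : exists k : 'I_n, x (vtx_src k) = x (vtx_tgt k).
  by apply: contrapT => /forallNP nk; apply: dg; apply/asboolP.
by rewrite (nclass_degenerate xk) raddf0 (@nclass_degenerate _ _ (f \o x) k) //= xk.
Qed.

Lemma nmap_nbd n (c : nchain X n.+1) : nmap n (nbd c) = nbd (nmap n.+1 c).
Proof.
move: c; apply: freeg_gen => [|x y bx by_|s]; first by rewrite !raddf0.
  by rewrite !raddfB /= bx by_.
rewrite -nclass_val nbd_nclass nmap_nclass nbd_nclass raddf_sum /=.
by apply: eq_bigr => i _; rewrite additive_signZ nmap_nclass.
Qed.

End NerveMap.

Lemma nmap_id (X : Type) n (c : nchain X n) : nmap id n c = c.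
Proof.
move: c; apply: freeg_gen => [|x y bx by_|s]; first by rewrite !raddf0.
  by rewrite !raddfB /= bx by_.
by rewrite -nclass_val nmap_nclass.
Qed.

Lemma nmap_comp (X Y Z : Type) (g : Y -> Z) (f : X -> Y) n (c : nchain X n) :
  nmap (g \o f) n c = nmap g n (nmap f n c).
Proof.
move: c; apply: freeg_gen => [|x y bx by_|s]; first by rewrite !raddf0.
  by rewrite !raddfB /= bx by_.
by rewrite -nclass_val !nmap_nclass.
Qed.

Section Filtration.
Variables (R : realType) (X : emetric R).

Definition len n (x : simplex X n) : \bar R :=
  (\sum_(i < n) dist (x (vtx_src i)) (x (vtx_tgt i)))%E.

Lemma len_ge0 n (x : simplex X n) : (0 <= len x)%E.
Proof. by apply: sume_ge0 => i _; exact: dist_ge0. Qed.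

Lemma len_recl n (x : simplex X n.+1) :
  len x = (dist (x ord0) (x (lift ord0 ord0)) + len (face ord0 x))%E.
Proof.
rewrite /len big_ord_recl; congr (dist (x _) _ + _)%E; first exact: val_inj.
apply: eq_bigr => i _; congr (dist (x _) (x _)); exact: val_inj.
Qed.

Lemma len_face n (i : 'I_n.+2) (x : simplex X n.+1) : (len (face i x) <= len x)%E.
Proof.
elim: n i x => [|n IH] i x; first by rewrite /len big_ord0 len_ge0.
have [->|[j ->]] : i = ord0 \/ exists j : 'I_n.+2, i = lift ord0 j.
- by case: (unliftP ord0 i) => [j ->|->]; [right; exists j|left].
- by rewrite (len_recl x) leeDr // dist_ge0.
have ff : face ord0 (face (lift ord0 j) x) = face j (face ord0 x).
  by rewrite (@face_face _ _ _ ord0) // (_ : inord _ = ord0) //; apply: val_inj; rewrite /= inordK.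
rewrite (len_recl (face _ x)) (len_recl x) ff.
have -> : face (lift ord0 j) x ord0 = x ord0.
  by rewrite /face; congr x; apply: val_inj.
case: (unliftP ord0 j) => [k jk|j0].
  have -> : face (lift ord0 j) x (lift ord0 ord0) = x (lift ord0 ord0).
    by rewrite /face jk; congr x; apply: val_inj.
  by rewrite leeD2l.
rewrite j0 (len_recl (face ord0 x)) addeA leeD2r //.
have -> : face (lift ord0 ord0) x (lift ord0 ord0) = face ord0 x (lift ord0 ord0).
  by rewrite /face; congr x; apply: val_inj.
exact: dist_triangle.
Qed.

Variable l : {nonneg R}.

(* The span of a set of basis elements consists of the chains whose support
   lies in that set. *)
Definition filtered n : {pred nchain X n} :=
  fun c => all (fun s : nd_simplex X n => (len (val s) <= l%:num%:E)%E) (dom c).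

Arguments filtered : clear implicits.

Lemma filtered_zmod_closed n : zmod_closed (filtered n).
Proof.
split=> [|x y /allP fx /allP fy]; apply/allP => s; first by rewrite dom0.
by move=> /domB; rewrite mem_cat => /orP[/fx|/fy].
Qed.
HB.instance Definition _ n :=
  GRing.isZmodClosed.Build (nchain X n) (filtered n) (@filtered_zmod_closed n).

Lemma filtered_nclass n (x : simplex X n) :
  (len x <= l%:num%:E)%E -> nclass x \in filtered n.
Proof.
move=> lx; rewrite /nclass; case: insubP => [s _ sx|_]; last exact: rpred0.
by apply/allP => t; rewrite domU1 inE => /eqP->; rewrite sx.
Qed.

Lemma filtered_gen n (P : nchain X n -> Prop) :
  P 0 -> (forall x y, P x -> P y -> P (x - y)) ->
  (forall x : simplex X n, (len x <= l%:num%:E)%E -> P (nclass x)) ->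
  forall c, c \in filtered n -> P c.
Proof.
move=> P0 PB Pg c /allP fc.
have PN x : P x -> P (- x) by move=> Px; rewrite -sub0r; exact: PB.
have PD x y : P x -> P y -> P (x + y).
  by move=> Px Py; rewrite -[y]opprK; apply: PB => //; exact: PN.
have PM x k : P x -> P (x *+ k).
  by move=> Px; elim: k => [|k IH]; rewrite ?mulr0n // mulrS; exact: PD.
rewrite -(freeg_sumE c) big_seq; elim/big_ind: _ => // s /fc /Pg.
rewrite nclass_val -[coeff s c]intz -freegU_mulz => Ps; case: (coeff s c) => m.
  exact: PM.
by rewrite NegzE mulrNz; apply: PN; exact: PM.
Qed.

Record fchain n := FChain { fchain_val :> nchain X n; fchainP : fchain_val \in filtered n }.
HB.instance Definition _ n := [isSub for @fchain_val n].
HB.instance Definition _ n := [Choice of fchain n by <:].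
HB.instance Definition _ n := [SubChoice_isSubZmodule of fchain n by <:].

Arguments fchain : clear implicits.

Lemma filtered_nbd n (c : fchain n.+1) : nbd (val c) \in filtered n.
Proof.
case: c => /=; apply: filtered_gen => [|x y fx fy|x lx].
- by rewrite raddf0 rpred0.
- by rewrite raddfB rpredB.
rewrite nbd_nclass rpred_sum // => i _; rewrite -signr_odd.
have fi := filtered_nclass (le_trans (len_face i x) lx).
by case: odd; rewrite ?scaleN1r ?scale1r ?rpredN.
Qed.

Definition fbd_fun n (c : fchain n.+1) : fchain n := FChain (filtered_nbd c).

Lemma fbd_is_additive n : zmod_morphism (@fbd_fun n).
Proof. by move=> x y; apply: val_inj; rewrite /= raddfB. Qed.
HB.instance Definition _ n :=
  GRing.isZmodMorphism.Build (fchain n.+1) (fchain n) (@fbd_fun n)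
    (@fbd_is_additive n).

Lemma fbd_fbd n (c : fchain n.+2) : fbd_fun (fbd_fun c) = 0.
Proof. by apply: val_inj; rewrite /= nbd_nbd. Qed.

Definition FC : chain_complex :=
  @ChainComplex (fun n => fchain n) (fun n => @fbd_fun n) fbd_fbd.

End Filtration.

Arguments filtered {R} X l n.
Arguments fchain {R} X l n.
Arguments FC {R} X l.

Section FiltrationMap.
Variables (R : realType) (X Y : emetric R) (f : nonexpansive X Y).
Variables (l l' : {nonneg R}) (ll' : l <= l').

Lemma nmap_filtered n (c : fchain X l n) :
  nmap f n (val c) \in filtered Y l' n.
Proof.
case: c => /=; apply: filtered_gen => [|x y fx fy|x lx].
- by rewrite raddf0 rpred0.
- by rewrite raddfB rpredB.
rewrite nmap_nclass filtered_nclass // (@le_trans _ _ (l%:num%:E)) ?lee_fin //.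
apply: le_trans lx; apply: lee_sum => i _; exact: nefun_le.
Qed.

Definition fchain_map n (c : fchain X l n) : fchain Y l' n :=
  FChain (nmap_filtered c).

Lemma fchain_map_is_additive n : zmod_morphism (@fchain_map n).
Proof. by move=> x y; apply: val_inj; rewrite /= raddfB. Qed.
HB.instance Definition _ n :=
  GRing.isZmodMorphism.Build (fchain X l n) (fchain Y l' n) (@fchain_map n)
    (@fchain_map_is_additive n).

Lemma fchain_map_bd n (c : FC X l n.+1) :
  fchain_map (bd n c : FC X l n) = bd n (fchain_map c : FC Y l' n.+1).
Proof. by apply: val_inj; rewrite /= nmap_nbd. Qed.

Definition FC_map : chain_map (FC X l) (FC Y l') :=
  @ChainMap (FC X l) (FC Y l') (fun n => @fchain_map n) fchain_map_bd.

End FiltrationMap.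

Section Persistence.
Variable R : realType.

Definition Length : category := poset_category {nonneg R}.

Definition Pers : category := functor_category Length Ab.

Program Definition FC_functor (X : emetric R) : functor Length Ch :=
  @Functor Length Ch (FC X)
    (fun l l' ll' => FC_map (idm (X : Met R)) (ll' : l <= l')) _ _.
Next Obligation.
move=> X l; apply: chain_map_ext => n c /=; apply: val_inj => /=.
exact: nmap_id.
Qed.
Next Obligation.
move=> X l l' l'' h k; apply: chain_map_ext => n c /=; apply: val_inj => /=.
by rewrite !nmap_id.
Qed.

Program Definition Filt : functor (Met R) (functor_category Length Ch) :=
  @Functor (Met R) (functor_category Length Ch) FC_functor
    (fun X Y f => @Nattrans Length Ch (FC_functor X) (FC_functor Y)
       (fun l => FC_map f (lexx l)) _) _ _.
Next Obligation.
move=> X Y f l l' h; apply: chain_map_ext => n c /=; apply: val_inj => /=.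
by rewrite !nmap_id.
Qed.
Next Obligation.
move=> X; apply: nattrans_ext => l; apply: chain_map_ext => n c /=.
by apply: val_inj => /=; exact: nmap_id.
Qed.
Next Obligation.
move=> X Y Z g f; apply: nattrans_ext => l; apply: chain_map_ext => n c /=.
by apply: val_inj => /=; exact: nmap_comp.
Qed.

Definition PH (n : nat) : functor (Met R) Pers :=
  postcompose Length (Hlgy n) ∘F Filt.

(* shift2_le is the relation l <= l + 2 e, the right-hand side being written
   (l + e) + e as in the codomain of a composite of two shifted maps. *)
Definition shift (e l : {nonneg R}) : Length := (l%:num + e%:num)%:nng.

Lemma shift_le (e l l' : {nonneg R}) : l <= l' -> shift e l <= shift e l'.
Proof. by move=> ll'; rewrite -num_le /= lerD2r. Qed.

Lemma shift2_le (e l : {nonneg R}) : l <= shift e (shift e l).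
Proof. by rewrite -num_le /= -addrA lerDl addr_ge0. Qed.

Record interleaving (e : {nonneg R}) (M N : Pers) := Interleaving {
  il_phi : forall l : Length, hom (M l) (N (shift e l));
  il_psi : forall l : Length, hom (N l) (M (shift e l));
  il_phi_nat : forall (l l' : Length) (h : l <= l'),
    il_phi l' ∘ fmor M h = fmor N (shift_le e h) ∘ il_phi l;
  il_psi_nat : forall (l l' : Length) (h : l <= l'),
    il_psi l' ∘ fmor N h = fmor M (shift_le e h) ∘ il_psi l;
  il_psi_phi : forall l : Length,
    il_psi (shift e l) ∘ il_phi l = fmor M (shift2_le e l);
  il_phi_psi : forall l : Length,
    il_phi (shift e l) ∘ il_psi l = fmor N (shift2_le e l) }.

Definition interleaving_distance (M N : Pers) : \bar R :=
  ereal_inf [set (e%:num)%:E | e in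
    [set e : {nonneg R} | inhabited (interleaving e M N)]].

End Persistence.

Section ComparisonMap.
Variables (R : realType) (Sg : signature).
Implicit Types U : set (set (qeq Sg) * qeq Sg).

Definition term_monad U (Free : left_adjoint (forget R U)) : monad (Met R) :=
  induced_monad Free.

Definition PHT (n : nat) U (Free : left_adjoint (forget R U)) :
    functor (Met R) (Pers R) :=
  PH R n ∘F term_monad Free.

(* The second clause: q A underlies a morphism of Mod U from Free A to Free' A. *)
Definition is_comparison U U' (UU' : U `<=` U')
    (Free : left_adjoint (forget R U)) (Free' : left_adjoint (forget R U'))
    (q : nattrans (term_monad Free) (term_monad Free')) : Prop :=
  forall A : Met R,
    q A ∘ munit (term_monad Free) A = munit (term_monad Free') A /\
    exists g : hom (Free A) (Mod_inclusion UU' (Free' A)),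
      fmor (forget R U) g = q A.

End ComparisonMap.

(* Main.v *)
(** The component [q_A] is the adjoint transpose of [eta^U'_A], where [Free' A] is
    regarded as a model of [U]; naturality, uniqueness and compatibility with the
    multiplications hold because two homomorphisms out of [Free A] that agree on
    the unit are equal. Every element of [Free' A] is the value of a term over
    [A], and [q_A] preserves such values, so it is surjective. If [q_A] is
    bijective with distortion at most delta, its inverse lengthens a k-simplex by
    at most k delta; hence it sends n-cycles of length l to n-cycles of length
    l + n delta, and boundaries of (n+1)-chains to boundaries at l + (n+1) delta.
    Together with [q_A] this is an (n+1) delta-interleaving on H_n. *)
Require Import Defs.
From HB Require Import structures.
From mathcomp.multinomials Require Import freeg.
From mathcomp Require Import all_boot all_order all_algebra.
From mathcomp Require Import boolp classical_sets functions cardinality reals.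
From mathcomp Require Import interval_inference constructive_ereal ereal.

Set Implicit Arguments.
Unset Strict Implicit.
Unset Printing Implicit Defensive.

Import Order.TTheory GRing.Theory Num.Theory.

Local Open Scope classical_set_scope.
Local Open Scope ring_scope.
Local Open Scope cat_scope.

(* [hom] and [compA] are shadowed by the library imports. *)
Local Notation hom := Defs.hom.
Local Notation compA := Defs.compA.

(** * Adjoint transposes *)

Section Transpose.
Variables (C D : category) (G : functor D C) (F : left_adjoint G).
Let adj := ladj_adjunction F.

Definition transpose (a : C) (b : D) (f : hom a (G b)) : hom (F a) b :=
  adj_counit adj b ∘ fmor F f.

Lemma transpose_unit (a : C) (b : D) (f : hom a (G b)) :
  fmor G (transpose f) ∘ adj_unit adj a = f.
Proof.
rewrite /transpose fmorM -compA -(naturality (adj_unit adj) f) compA.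
by rewrite adj_triangleG comp1m.
Qed.

(** Naturality of the counit along [g] and the first triangle identity collapse the right-hand side
    to [g]. *)
Lemma transpose_uniq (a : C) (b : D) (g : hom (F a) b) :
  g = transpose (fmor G g ∘ adj_unit adj a).
Proof.
rewrite /transpose fmorM compA.
rewrite (naturality (adj_counit adj) g : _ ∘ fmor F (fmor G g) = _).
by rewrite -compA adj_triangleF compm1.
Qed.

Lemma hom_free_eq (a : C) (b : D) (g h : hom (F a) b) :
  fmor G g ∘ adj_unit adj a = fmor G h ∘ adj_unit adj a -> g = h.
Proof. by move=> gh; rewrite (transpose_uniq g) (transpose_uniq h) gh. Qed.

End Transpose.

(** Kept transparent, so that the component formula for [PH R n] applied to the comparison holds by
    computation. *)
Definition whisker (C D E : category) (H : functor D E) (F F' : functor C D)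
    (q : nattrans F F') : nattrans (H ∘F F) (H ∘F F').
Proof.
exists (fun a => fmor H (q a)) => a b f /=.
by rewrite -!fmorM naturality.
Defined.

(** * Maps induced on a single homology group *)

Section PartialHomologyMap.
(* A map that raises distances by at most delta raises lengths of k-simplices by
   k delta, so it has no chain map into a uniformly shifted filtration step; only
   the degrees n and n + 1 matter for its effect on H_n. *)
Variables (C D : chain_complex) (n : nat) (f : {additive C n -> D n}).
Hypothesis f_cycle : forall z : hcycle C n, f (val z) \in is_cycle D n.
Hypothesis f_boundary :
  forall c : C n.+1, exists d : D n.+1, bd n d = f (bd n c).

Definition degree_hcycle_map (z : hcycle C n) : hcycle D n := HCycle (f_cycle z).

Definition degree_homology_map_fun (h : homology C n) : homology D n :=
  hclass (degree_hcycle_map (repr h)).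

(** Independence of the representative: two representatives differ by a boundary, and [f_boundary]
    sends it to a boundary. *)
Lemma degree_homology_map_hclass (z : hcycle C n) :
  degree_homology_map_fun (hclass z) = hclass (degree_hcycle_map z).
Proof.
apply/hclass_eq; have /hclass_eq[c bc] : hclass (repr (hclass z)) = hclass z.
  by rewrite /hclass reprK.
by have [d dc] := f_boundary c; exists d; rewrite dc bc raddfB.
Qed.

Lemma degree_homology_map_is_additive : zmod_morphism degree_homology_map_fun.
Proof.
move=> h k; have [[y ->] [z ->]] := (hclass_surj h, hclass_surj k).
have hB (E : chain_complex) (u v : hcycle E n) :
  hclass (u - v) = hclass u - hclass v by rewrite /hclass raddfB.
rewrite -hB !degree_homology_map_hclass -hB; congr hclass.
by apply: val_inj; rewrite /= raddfB.
Qed.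
HB.instance Definition _ :=
  GRing.isZmodMorphism.Build (homology C n) (homology D n)
    degree_homology_map_fun degree_homology_map_is_additive.

Definition degree_homology_map : {additive homology C n -> homology D n} :=
  degree_homology_map_fun.

End PartialHomologyMap.

(** * Filtered chains under maps with additive distortion *)

Section AlmostNonexpansive.
Variables (R : realType) (X Y : emetric R) (g : X -> Y) (delta : {nonneg R}).
Hypothesis g_le : forall x y, (dist (g x) (g y) <= dist x y + delta%:num%:E)%E.

Lemma len_comp n (x : simplex X n) :
  (len (g \o x : simplex Y n) <= len x + (n%:R * delta%:num)%:E)%E.
Proof.
have -> : (n%:R * delta%:num)%:E = (\sum_(i < n) delta%:num%:E)%E.
  by rewrite sumEFin sumr_const card_ord mulr_natl.
by rewrite /len -big_split; apply: lee_sum => i _; exact: g_le.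
Qed.

Variables (l l' : {nonneg R}) (n : nat).
Hypothesis ll' : l%:num + n%:R * delta%:num <= l'%:num.

Lemma nmap_filtered_almost (c : fchain X l n) : nmap g n (val c) \in filtered Y l' n.
Proof.
case: c => /=; apply: filtered_gen => [|x y fx fy|x lx].
- by rewrite raddf0 rpred0.
- by rewrite raddfB rpredB.
rewrite nmap_nclass filtered_nclass //; apply: le_trans (len_comp x) _.
apply: (@le_trans _ _ (l%:num%:E + (n%:R * delta%:num)%:E)%E).
  by rewrite leeD2r.
by rewrite -EFinD lee_fin.
Qed.

Definition almost_fchain_map (c : fchain X l n) : fchain Y l' n :=
  FChain (nmap_filtered_almost c).

Lemma almost_fchain_map_is_additive : zmod_morphism almost_fchain_map.
Proof. by move=> x y; apply: val_inj; rewrite /= raddfB. Qed.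
HB.instance Definition _ :=
  GRing.isZmodMorphism.Build (fchain X l n) (fchain Y l' n) almost_fchain_map
    almost_fchain_map_is_additive.

End AlmostNonexpansive.

(** * Homology under maps with additive distortion *)

Section AlmostHomologyMap.
Variables (R : realType) (X Y : emetric R) (g : X -> Y) (delta : {nonneg R}).
Hypothesis g_le : forall x y, (dist (g x) (g y) <= dist x y + delta%:num%:E)%E.
Variables (l l' : {nonneg R}) (n : nat).
Hypothesis ll' : l%:num + n.+1%:R * delta%:num <= l'%:num.

(** Lets cycles and the chains that bound them share the level [l']. *)
Lemma almost_degree_le : l%:num + n%:R * delta%:num <= l'%:num.
Proof. by apply: le_trans ll'; rewrite lerD2l ler_wpM2r // ler_nat. Qed.

Let f : {additive FC X l n -> FC Y l' n} :=
  almost_fchain_map g_le almost_degree_le.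

Lemma almost_cycle (z : hcycle (FC X l) n) : f (val z) \in is_cycle (FC Y l') n.
Proof.
(* The bound mentions [n], so it is generalised before the case split. In degree 0 every chain is a
   cycle. *)
rewrite /f; move: almost_degree_le; case: z => /= c.
rewrite !unfold_in /is_cycle; move: c; case: (n) => //= m c /eqP bc h.
apply/eqP/val_inj; rewrite /= -nmap_nbd.
by rewrite (congr1 val bc : nbd (val c) = 0) raddf0.
Qed.

Lemma almost_boundary (c : FC X l n.+1) :
  exists d : FC Y l' n.+1, bd n d = f (bd n c).
Proof.
(* The bounding chain has degree [n.+1]; this is where the factor [n.+1] in [ll'] comes from. *)
exists (almost_fchain_map g_le ll' c).
by apply: val_inj; rewrite /= nmap_nbd.
Qed.

Definition almost_homology_map :
    {additive homology (FC X l) n -> homology (FC Y l') n} :=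
  degree_homology_map almost_cycle almost_boundary.

Lemma almost_homology_mapE (z : hcycle (FC X l) n) :
  almost_homology_map (hclass z) = hclass (degree_hcycle_map almost_cycle z).
Proof. exact: degree_homology_map_hclass almost_boundary z. Qed.

Lemma almost_hcycle_map_chain (z : hcycle (FC X l) n) :
  fchain_val (hcycle_val (degree_hcycle_map almost_cycle z)) =
  nmap g n (fchain_val (hcycle_val z)).
Proof. by []. Qed.

End AlmostHomologyMap.

(** * The interleaving of persistent homology *)

Lemma le_shift (R : realType) (e l : {nonneg R}) : l <= shift e l.
Proof. by rewrite -num_le /= lerDl. Qed.

(** Reduces each interleaving identity to one between unfiltered chains: the proofs of filtration
    level and of being a cycle are irrelevant. *)
Lemma hclass_fchain_eq (R : realType) (X : emetric R) (l : {nonneg R}) n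
    (y z : hcycle (FC X l) n) :
  fchain_val (hcycle_val y) = fchain_val (hcycle_val z) -> hclass y = hclass z.
Proof. by move=> yz; congr hclass; apply: val_inj; exact: (val_inj yz). Qed.

Lemma hcycle_map_chain (R : realType) (X Y : emetric R) (f : nonexpansive X Y)
    (l l' : {nonneg R}) (ll' : l <= l') n (z : hcycle (FC X l) n) :
  fchain_val (hcycle_val (hcycle_map (FC_map f ll') z)) =
  nmap f n (fchain_val (hcycle_val z)).
Proof. by []. Qed.

Section Stability.
Variables (R : realType) (X Y : emetric R) (f : nonexpansive X Y) (g : Y -> X).
Hypotheses (fK : cancel f g) (gK : cancel g f).
Variables (delta : {nonneg R}) (n : nat).
Hypothesis f_le : forall x y, (dist x y <= dist (f x) (f y) + delta%:num%:E)%E.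

Let e : {nonneg R} := (n.+1%:R * delta%:num)%:nng.

Lemma inverse_almost x y : (dist (g x) (g y) <= dist x y + delta%:num%:E)%E.
Proof. by rewrite -{2}(gK x) -{2}(gK y). Qed.

Lemma PH_interleaving : inhabited (interleaving e (PH R n X) (PH R n Y)).
Proof.
have transE Z (l l' : Length R) (h : l <= l') (z : hcycle (FC Z l) n) :
    fmor (PH R n Z) h (hclass z) =
    hclass (hcycle_map (FC_map (idm (Z : Met R)) h) z).
  exact: homology_map_hclass.
(* A nonexpansive [f] preserves levels; the shift by [e] is a mere inclusion. Only the values on
   classes are kept, and they determine the map. *)
have [phi phiE] : exists phi :
    forall l : Length R, hom (PH R n X l) (PH R n Y (shift e l)),
    forall l z, phi l (hclass z) = hclass (hcycle_map (FC_map f (le_shift e l)) z).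
  exists (fun l => homology_map (FC_map f (le_shift e l)) n) => l z.
  exact: homology_map_hclass.
have shiftE (l : Length R) :
  l%:num + n.+1%:R * delta%:num <= (shift e l : {nonneg R})%:num by [].
have [psi psiE] : exists psi :
    forall l : Length R, hom (PH R n Y l) (PH R n X (shift e l)),
    forall l z, psi l (hclass z) =
      hclass (degree_hcycle_map (almost_cycle inverse_almost (shiftE l)) z).
  exists (fun l => almost_homology_map inverse_almost (shiftE l)) => l z.
  exact: almost_homology_mapE.
constructor; exists phi psi => [l l' h|l l' h|l|l]; apply: additive_ext => c;
  have [z ->] := hclass_surj c.
(* Transition maps act as the identity on chains, so both sides are represented by the image of [z]
   under [nmap f]. *)
- change (phi l' (fmor (PH R n X) h (hclass z)) =
          fmor (PH R n Y) (shift_le e h) (phi l (hclass z))).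
  rewrite (transE _ _ _ h) (phiE l) (phiE l') (transE _ _ _ (shift_le e h)); apply: hclass_fchain_eq.
  rewrite !(hcycle_map_chain, almost_hcycle_map_chain).
  by rewrite !nmap_id.
- change (psi l' (fmor (PH R n Y) h (hclass z)) =
          fmor (PH R n X) (shift_le e h) (psi l (hclass z))).
  rewrite (transE _ _ _ h) (psiE l) (psiE l') (transE _ _ _ (shift_le e h)); apply: hclass_fchain_eq.
  rewrite !(hcycle_map_chain, almost_hcycle_map_chain).
  by rewrite !nmap_id.
(* The round trip applies [g \o f = id] to each vertex, so on chains it is the inclusion. *)
- change (psi (shift e l) (phi l (hclass z)) =
          fmor (PH R n X) (shift2_le e l) (hclass z)).
  rewrite transE phiE psiE; apply: hclass_fchain_eq.
  rewrite !(hcycle_map_chain, almost_hcycle_map_chain).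
  by rewrite nmap_id -nmap_comp (_ : g \o f = id) ?nmap_id //; exact/funext.
- change (phi (shift e l) (psi l (hclass z)) =
          fmor (PH R n Y) (shift2_le e l) (hclass z)).
  rewrite transE psiE phiE; apply: hclass_fchain_eq.
  rewrite !(hcycle_map_chain, almost_hcycle_map_chain).
  by rewrite nmap_id -nmap_comp (_ : f \o g = id) ?nmap_id //; exact/funext.
Qed.

Lemma PH_interleaving_distance :
  (interleaving_distance (PH R n X) (PH R n Y) <= (n.+1%:R * delta%:num)%:E)%E.
Proof.
by apply: ereal_inf_lbound; exists e => //; exact: PH_interleaving.
Qed.

End Stability.

(** * The comparison of the two term monads *)

Section Comparison.
Variables (R : realType) (Sg : signature) (U U' : set (set (qeq Sg) * qeq Sg)).
Hypothesis UU' : U `<=` U'.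
Variables (Free : left_adjoint (forget R U)) (Free' : left_adjoint (forget R U')).

(** [Mod_inclusion] keeps underlying spaces, so the unit of [Free'] typechecks as a map into the
    space of a model of [U]. *)
Definition comparison_hom (A : Met R) :
    hom (Free A) (Mod_inclusion UU' (Free' A)) :=
  @transpose _ _ _ Free A (Mod_inclusion UU' (Free' A))
    (munit (term_monad Free') A).

Definition comparison_map (A : Met R) :
    hom (term_monad Free A) (term_monad Free' A) :=
  fmor (forget R U) (comparison_hom A).

Lemma comparison_unit (A : Met R) :
  comparison_map A ∘ munit (term_monad Free) A = munit (term_monad Free') A.
Proof.
exact: (@transpose_unit _ _ _ Free A (Mod_inclusion UU' (Free' A))).
Qed.

(** The form of [hom_free_eq] suited to equations in [Met], where the maps are only known to lift to
    homomorphisms. *)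
Lemma underlying_eq (A : Met R) (B : Mod R U)
    (f h : hom (term_monad Free A) (forget R U B)) :
  (exists g, fmor (forget R U) g = f) -> (exists g, fmor (forget R U) g = h) ->
  f ∘ munit (term_monad Free) A = h ∘ munit (term_monad Free) A -> f = h.
Proof.
by move=> [f' <-] [h' <-] fh; rewrite (@hom_free_eq _ _ _ Free A B f' h' fh).
Qed.

Lemma comparison_natural (A B : Met R) (f : hom A B) :
  comparison_map B ∘ fmor (term_monad Free) f =
  fmor (term_monad Free') f ∘ comparison_map A.
Proof.
apply: (@underlying_eq A (Mod_inclusion UU' (Free' B))).
- by exists (comparison_hom B ∘ fmor Free f); exact: fmorM.
- exists (fmor (Mod_inclusion UU') (fmor Free' f) ∘ comparison_hom A).
  exact: (@fmorM _ _ (forget R U)).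
have unitE := naturality (munit (term_monad Free)) f.
have unitE' := naturality (munit (term_monad Free')) f.
change (comparison_map B ∘ fmor (term_monad Free) f ∘ munit (term_monad Free) A =
  fmor (term_monad Free') f ∘ comparison_map A ∘ munit (term_monad Free) A).
(* Both sides become [munit (term_monad Free') B ∘ f]. *)
rewrite -(compA (comparison_map B)) -(compA _ (comparison_map A)).
by rewrite comparison_unit -unitE -unitE' compA comparison_unit.
Qed.

Definition comparison : nattrans (term_monad Free) (term_monad Free') :=
  Nattrans comparison_natural.

Lemma comparisonP : is_comparison UU' comparison.
Proof. by move=> A; split; [exact: comparison_unit | exists (comparison_hom A)]. Qed.

Lemma comparison_uniq (q : nattrans (term_monad Free) (term_monad Free')) :
  is_comparison UU' q -> q = comparison.
Proof.
move=> qP; apply: nattrans_ext => A; have [qu qh] := qP A.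
have [cu ch] := comparisonP A.
apply: (@underlying_eq A (Mod_inclusion UU' (Free' A))) => //.
by rewrite qu cu.
Qed.

Lemma comparison_monad_morphism : monad_morphism comparison.
Proof.
split=> [A|A]; first exact: comparison_unit.
apply: (@underlying_eq (term_monad Free A) (Mod_inclusion UU' (Free' A))).
- exists (comparison_hom A ∘ adj_counit (ladj_adjunction Free) (Free A)).
  exact: fmorM.
- exists (fmor (Mod_inclusion UU') (adj_counit (ladj_adjunction Free') (Free' A))
    ∘ (comparison_hom (term_monad Free' A) ∘ fmor Free (comparison_map A))).
  by rewrite (@fmorM _ _ (forget R U)) fmorM.
set q := comparison_map; set S := term_monad Free; set T := term_monad Free'.
have unitE := naturality (munit S) (q A).
change (q A ∘ mmul S A ∘ munit S (S A) =
  mmul T A ∘ (q (T A) ∘ fmor S (q A)) ∘ munit S (S A)).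
(* Precomposed with the unit at [S A], both sides equal [q A], by the left unit laws of [S] and
   [T]. *)
rewrite -(compA (q A)) -(compA (mmul T A)) -(compA (q (T A))) -unitE.
rewrite (compA (q (T A))) comparison_unit (compA (mmul T A)).
by rewrite !mmul1m comp1m compm1.
Qed.

(** By induction on [t]: the unit equation settles variables, and the homomorphism property settles
    operations. *)
Lemma comparison_term_fold (A : Met R) (t : term Sg A) :
  comparison_map A
    (term_fold (@qop _ _ (sval (Free A))) (munit (term_monad Free) A) t) =
  term_fold (@qop _ _ (sval (Free' A))) (munit (term_monad Free') A) t.
Proof.
elim: t => [x|f ts IH] /=.
  exact: (congr1 (fun h : nonexpansive _ _ => h x) (comparison_unit A)).
rewrite [LHS](@qhom_op _ _ _ _ (comparison_hom A)); congr qop.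
by apply/funext => i; exact: IH.
Qed.

(* The identity of Free' A factors through the concrete free model, on whose
   classes of terms the second factor is evaluation. *)
Lemma free_generated (A : Met R) (s : term_monad Free' A) :
  exists t : term Sg A,
    s = term_fold (@qop _ _ (sval (Free' A))) (munit (term_monad Free') A) t.
Proof.
pose h : hom (free_model U' A) (Free' A) :=
  @free_hom R Sg U' A (Free' A) (munit (term_monad Free') A).
pose k : hom (Free' A) (free_model U' A) :=
  @transpose _ _ _ Free' A (free_model U' A) (free_unit U' A).
have hk : h ∘ k = idm (Free' A).
  apply: hom_free_eq; rewrite fmorM -compA fmor1 comp1m.
  rewrite (@transpose_unit _ _ _ Free' A (free_model U' A) (free_unit U' A)).
  by apply: nonexpansive_ext => x; exact: free_hom_unit.
exists (free_repr (k s)).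
exact: (esym (congr1 (fun h : qalg_hom _ _ => h s) hk)).
Qed.

Lemma comparison_surjective (A : Met R) (s : term_monad Free' A) :
  exists t : term_monad Free A, comparison A t = s.
Proof.
have [t ->] := free_generated s.
exists (term_fold (@qop _ _ (sval (Free A))) (munit (term_monad Free) A) t).
exact: comparison_term_fold.
Qed.

End Comparison.

Theorem theorem7p2 (R : realType) (Sg : signature)
    (U U' : set (set (qeq Sg) * qeq Sg))
    (thU : quantitative_theory U) (thU' : quantitative_theory U')
    (UU' : U `<=` U')
    (Free : left_adjoint (forget R U)) (Free' : left_adjoint (forget R U'))
    (n : nat) :
  [/\ (forall B : QAlg R Sg, is_model U' B -> is_model U B),
      (forall A : Met R, is_model U (sval (Free' A))) &
      exists q : nattrans (term_monad Free) (term_monad Free'),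
      [/\ is_comparison UU' q /\
          (forall q' : nattrans (term_monad Free) (term_monad Free'),
             is_comparison UU' q' -> q' = q),
          monad_morphism q,
          (forall (A : Met R) (s : term_monad Free' A),
             exists t : term_monad Free A, q A t = s),
          (exists p : nattrans (PHT n Free) (PHT n Free'),
             forall A : Met R, p A = fmor (PH R n) (q A)) &
          (forall (A : Met R) (delta : {nonneg R}),
             bijective (q A) ->
             (forall t s : term_monad Free A,
                (dist t s <= dist (q A t) (q A s) + delta%:num%:E)%E) ->
             (interleaving_distance (PHT n Free A) (PHT n Free' A)
                <= (n.+1%:R * delta%:num)%:E)%E)]].
Proof.
split; first by move=> B; exact: is_model_sub.
  by move=> A; exact: is_model_sub UU' (svalP (Free' A)).
exists (comparison UU' Free Free'); split.
- by split; [exact: comparisonP | exact: comparison_uniq].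
- exact: comparison_monad_morphism.
- exact: comparison_surjective.
- by exists (whisker (PH R n) (comparison UU' Free Free')).
(* The inverse [g] is a bare function; its distortion bound comes from [q_le]. *)
- move=> A delta [g qK gK] q_le.
  apply: (@PH_interleaving_distance R (term_monad Free A) (term_monad Free' A)
    (comparison UU' Free Free' A) g qK gK delta n).
  exact: q_le.
Qed.
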